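(* Let $\mathcal{T}_1$ and $\mathcal{T}_2$ be two distinct (vertex-disjoint) stacked components, each isomorphic to the graph specified in the context. If the new edge $\mathcal{E}$ joins a floor vertex of $\mathcal{T}_1$ to a floor vertex of $\mathcal{T}_2$, then $$\mathrm{diam}(\mathcal{T}_1+\mathcal{E}+\mathcal{T}_2)=\mathrm{ord}(\ell)+4,$$ where $\mathcal{T}_1+\mathcal{E}+\mathcal{T}_2$ is the disjoint union of $\mathcal{T}_1$ and $\mathcal{T}_2$ together with the edge $\mathcal{E}$.
   Context: Let $p$ be a prime with $p\equiv 71$ or $119\pmod{120}$, let $\ell=2$, and let $\mathrm{ord}(\ell)$ be the order, in the ideal class group of $\mathbb{Q}(\sqrt{-p})$, of a prime ideal above $2$; it is an odd integer $\ge 3$. A stacked component $\mathcal{T}$ (a component of the supersingular $2$-isogeny graph over $\mathbb{F}_p$ after identifying curves up to $\overline{\mathbb{F}_p}$-isomorphism, regarded as a simple undirected graph) is, writing $L=\mathrm{ord}(\ell)$, labelled so that $V(\mathcal{T})=\{0,1,\dots,2L-1\}$ and $$E(\mathcal{T})=\{\{2i,2i+1\}:0\le i\le L-1\}\cup\{\{2i+1,2i+3\}:0\le i\le L-2\}\cup\{\{2L-1,1\}\}.$$ The floor vertices of $\mathcal{T}$ are the even vertices. The new edge $\mathcal{E}$ is the single edge coming from $2$-isogenies not defined over $\mathbb{F}_p$ that must be added to obtain the spine; its endpoints are always two distinct floor vertices. The diameter is the maximum graph distance between two vertices. *)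

(* Defs.v *)
From HB Require Import structures.
From mathcomp Require Import all_boot all_order all_algebra all_field.
From mathcomp Require Import boolp classical_sets ring.

Set Implicit Arguments.
Unset Strict Implicit.
Unset Printing Implicit Defensive.

Import GRing.Theory Num.Theory.
Local Open Scope classical_set_scope.
Local Open Scope ring_scope.

(* [Q(sqrt(-p))] is realised inside [algC] as the set of [a + b * sqrt(-p)]
   with [a], [b] rational. *)
Definition quad_field (p : nat) : {pred algC} :=
  Crat_span [:: 1; sqrtC (- p%:R)].

Lemma quad_fieldP p x :
  reflect (exists a b : rat, x = ratr a + ratr b * sqrtC (- p%:R))
          (x \in quad_field p).
Proof.
apply: (iffP (Crat_spanP _ _)) => [[c ->]|[a [b ->]]].
  by exists (c ord0), (c (lift ord0 ord0)); rewrite !big_ord_recl big_ord0 /= mulr1 addr0.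
exists [ffun i : 'I_2 => if i == ord0 then a else b].
by rewrite !big_ord_recl big_ord0 /= !ffunE mulr1 addr0.
Qed.

Definition quad_int_pred (p : nat) : {pred algC} :=
  [predI Aint & quad_field p].

Fact quad_int_subring p : subring_closed (quad_int_pred p).
Proof.
split.
- by rewrite inE Aint1; apply/quad_fieldP; exists 1, 0; rewrite rmorph1 rmorph0 mul0r addr0.
- move=> x y /andP[/= xA xK] /andP[/= yA yK]; rewrite inE /= rpredB //=.
  apply/quad_fieldP; case/quad_fieldP: xK => a [b ->]; case/quad_fieldP: yK => c [d ->].
  by exists (a - c), (b - d); rewrite !rmorphB mulrBl opprD addrACA.
- move=> x y /andP[/= xA /quad_fieldP[a [b Dx]]] /andP[/= yA /quad_fieldP[c [d Dy]]].
  rewrite inE /= rpredM //=.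
  apply/quad_fieldP; exists (a * c - b * d * p%:R), (a * d + b * c).
  rewrite Dx Dy rmorphB !rmorphD !rmorphM rmorph_nat /=.
  have := sqrtCK (- p%:R : algC); move: (sqrtC _) => s Ds.
  ring: Ds.
Qed.

HB.instance Definition _ p :=
  GRing.isSubringClosed.Build algC (quad_int_pred p) (quad_int_subring p).

(* The ring of integers of [Q(sqrt(-p))]. *)
Record quad_int (p : nat) := QuadInt {
  quad_int_val :> algC;
  _ : quad_int_val \in quad_int_pred p
}.

HB.instance Definition _ p := [isSub for @quad_int_val p].
HB.instance Definition _ p := [Choice of quad_int p by <:].
HB.instance Definition _ p :=
  [SubChoice_isSubComNzRing of quad_int p by <:].

Section Ideals.
Variable R : comNzRingType.
Implicit Types (I J : set R) (n : nat).

Definition ideal_mul I J : set R :=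
  [set x | exists n (a b : 'I_n -> R),
     [/\ forall i, I (a i), forall i, J (b i) & x = \sum_(i < n) a i * b i]].

Definition ideal_exp I n : set R := iter n (ideal_mul I) setT.

Definition ideal_scale (a : R) I : set R := [set a * x | x in I].

(* Two nonzero ideals of a domain define the same ideal class. *)
Definition same_ideal_class I J : Prop :=
  exists a b : R, [/\ a != 0, b != 0 & ideal_scale a I = ideal_scale b J].

(* The identity of the class group is the class of the unit ideal [setT]. *)
Definition ideal_class_order I n : Prop :=
  [/\ (0 < n)%N, same_ideal_class (ideal_exp I n) setT &
      forall m, (0 < m < n)%N -> ~ same_ideal_class (ideal_exp I m) setT].

End Ideals.

(* An undirected graph on a finite type is given by its adjacency relation. *)
Section Graphs.
Local Open Scope nat_scope.

Section Diameter.
Variables (V : finType) (e : rel V).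

Definition has_walk (x y : V) (n : nat) : Prop :=
  exists s : seq V, [/\ size s = n, path e x s & last x s = y].

Definition graph_distance (x y : V) (n : nat) : Prop :=
  has_walk x y n /\ forall m, has_walk x y m -> n <= m.

(* In particular the graph is connected. *)
Definition graph_diameter (d : nat) : Prop :=
  (forall x y, exists2 n, graph_distance x y n & n <= d) /\
  (exists x y, graph_distance x y d).

End Diameter.

Definition stacked_arc (L u v : nat) : bool :=
  [|| [exists i : 'I_L, (u == 2 * i) && (v == 2 * i + 1)],
      [exists i : 'I_(L - 1), (u == 2 * i + 1) && (v == 2 * i + 3)] |
      (u == 2 * L - 1) && (v == 1)].

Definition stacked_adj (L : nat) : rel 'I_(2 * L) :=
  fun u v => stacked_arc L u v || stacked_arc L v u.

Definition stacked_labelling (L : nat) (V : finType) (e : rel V)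
    (lab : V -> 'I_(2 * L)) : Prop :=
  bijective lab /\ forall x y, stacked_adj (lab x) (lab y) = e x y.

Definition floor_vertex (L : nat) (V : finType) (lab : V -> 'I_(2 * L))
    (x : V) : bool := ~~ odd (lab x).

(* The disjoint union of two graphs plus one edge joining [a] to [b]. *)
Definition join_edge (V1 V2 : finType) (e1 : rel V1) (e2 : rel V2)
    (a : V1) (b : V2) : rel (V1 + V2) :=
  fun u v => match u, v with
    | inl x, inl y => e1 x y
    | inr x, inr y => e2 x y
    | inl x, inr y => (x == a) && (y == b)
    | inr y, inl x => (x == a) && (y == b)
    end.

End Graphs.

(* Main.v *)
(* A stacked component is a cycle of length L with a pendant (floor) vertex at
   each cycle vertex. If L = 2h+1 with h > 0, a floor vertex has eccentricity
   h + 2, so the diameter of the joined graph is 2(h + 2) + 1 = L + 4. It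
   remains to see that L is odd and greater than 1.

   Write p = 4k - 1 with k even and O = Z[w], w^2 = w - k; the two primes above
   2 are (2, w) and (2, 1 - w), and exchanging w and 1 - w lets us assume
   P = (2, w). If r is an even root of X^2 - X + k modulo 2^n then
   P^n = (2^n, w - r). A generator c + d w of P^n has norm
   c^2 + c d + k d^2 = 2^n and coprime coordinates. For n = 1 this contradicts
   p > 8. If n = 2m, then x = 2c + d and d are odd and
     p d^2 = (2^(m+1) - x)(2^(m+1) + x)
   with coprime factors, so these are p u^2 and v^2 in some order; their sum
   p u^2 + v^2 = 2^(m+2) gives an element of norm 2^m with an odd coordinate,
   which generates P^m or its conjugate, and P^m is already principal. *)

Require Import Defs.
From mathcomp Require Import all_boot all_order all_algebra all_field.
From mathcomp Require Import boolp classical_sets ring zify.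
Import GRing.Theory.
Local Open Scope classical_set_scope.
Local Open Scope ring_scope.

Set Implicit Arguments.
Unset Strict Implicit.
Unset Printing Implicit Defensive.

Import Order.TTheory Num.Theory.

(** * Arithmetic of the norm form *)

Lemma even_root (k : int) n : (2 %| k)%Z ->
  exists s t : int, (2 * s) ^+ 2 - 2 * s + k = 2 ^+ n.+1 * t.
Proof.
case/dvdzP=> l ->; elim: n => [|n [s [t st]]].
  by exists 0, l; ring.
(* Hensel lifting: shifting [s] by [x = 2 ^+ n * t] adds [- 2 * x], which cancels the old value, and
   terms divisible by [2 ^+ n.+2]. *)
exists (s + 2 ^+ n * t), (2 * s * t + 2 ^+ n * t ^+ 2).
have -> : forall x : int, (2 * (s + x)) ^+ 2 - 2 * (s + x) + l * 2
    = ((2 * s) ^+ 2 - 2 * s + l * 2) + 8 * s * x + 4 * x ^+ 2 - 2 * x by move=> x; ring.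
rewrite st !exprS; ring.
Qed.

Lemma coprime_mul_sqr (p a b d : nat) : prime p -> coprime a b ->
  (a * b = p * d ^ 2)%N ->
  exists u v, (a = p * u ^ 2 /\ b = v ^ 2 \/ a = v ^ 2 /\ b = p * u ^ 2)%N.
Proof.
(* The square of [gcdn x z] is the gcd of [x * x], [x * z] and [z * z = x * y], that is [x] times
   the gcd of [x], [y], [z], which is 1. *)
have sqr_part x y z : coprime x y -> (x * y = z ^ 2)%N -> x = (gcdn x z ^ 2)%N.
  move=> xy xyz; rewrite -mulnn muln_gcdr !muln_gcdl [(z * z)%N]mulnn -xyz (mulnC z x).
  rewrite -!muln_gcdr; have /eqP-> : coprime (gcdn x z) (gcdn z y).
    by apply: coprime_dvdl (dvdn_gcdl _ _) (coprime_dvdr (dvdn_gcdr _ _) xy).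
  by rewrite muln1.
wlog pa : a b / (p %| a)%N.
  move=> wlog_a p_pr ab abE; have : (p %| a * b)%N by rewrite abE dvdn_mulr.
  rewrite Euclid_dvdM // => /orP[pa|pb]; first exact: wlog_a.
  have [|||u [v H]] := wlog_a b a pb; rewrite 1?coprime_sym 1?mulnC //.
  by exists u, v; case: H; [right|left]; tauto.
move=> p_pr ab abE; case/dvdnP: pa ab abE => a' ->; rewrite coprimeMl => /andP[a'b pb] abE.
have p0 := prime_gt0 p_pr.
have E : (a' * b = d ^ 2)%N.
  by apply/eqP; rewrite -(eqn_pmul2l p0) -abE; apply/eqP; ring.
exists (gcdn a' d), (gcdn b d); left; split.
  by rewrite mulnC {1}(sqr_part _ _ _ a'b E).
by apply: sqr_part (etrans (mulnC b a') E); rewrite coprime_sym.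
Qed.

Lemma dvdz2M (x y : int) : (2 %| x * y)%Z = (2 %| x)%Z || (2 %| y)%Z.
Proof. by rewrite !dvdzE abszM Euclid_dvdM. Qed.

Lemma norm_form_sqrt (p m : nat) (k c d e f : int) :
  prime p -> p%:Z = 4 * k - 1 -> (2 %| k)%Z -> (0 < m)%N ->
  c ^+ 2 + c * d + k * d ^+ 2 = 2 ^+ (2 * m) -> (c + d) * f + d * e = 1 ->
  exists c' d' : int, ~~ (2 %| d')%Z /\ c' ^+ 2 + c' * d' + k * d' ^+ 2 = 2 ^+ m.
Proof.
move=> p_pr pk k2 m0 cd ef.
have d_odd : ~~ (2 %| d)%Z.
  apply/negP=> d2; have c2 : (2 %| c)%Z.
    have : (2 %| c * c)%Z.
      have -> : c * c = 2 ^+ (2 * m) - (c * d + k * d * d) by rewrite -cd; ring.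
      rewrite rpredB ?rpredD ?dvdz_mull ?dvdz_mulr //.
      by case: m m0 {cd} => // m _; rewrite mulnS exprS dvdz_mulr.
    by rewrite dvdz2M orbb.
  have : (2 %| (c + d) * f + d * e)%Z by rewrite rpredD ?dvdz_mulr ?rpredD.
  by rewrite ef.
(* Four times the norm equation reads [z ^ 2 = x ^ 2 + p * y ^ 2]. *)
set x := absz (2 * c + d); set y := `|d|%N; set z := (2 ^ m.+1)%N.
have x_odd : odd x by rewrite /x; lia.
have z_even : ~~ odd z by rewrite /z oddX.
have xyz : (z ^ 2 = x ^ 2 + p * y ^ 2)%N.
  apply/eqP; rewrite -!mulnn -eqz_nat PoszD !PoszM !abszE -!expr2 !real_normK ?num_real //.
  rewrite pk /z -[Posz (2 ^ _)]natz natrX natz -exprM muln2 doubleS !exprS -mul2n -cd.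
  by apply/eqP; ring.
have xz : (x < z)%N.
  rewrite -ltn_sqr xyz -[X in (X < _)%N]addn0 ltn_add2l muln_gt0 prime_gt0 //=.
  by rewrite expn_gt0 lt0n /y; apply/orP; left; lia.
have xzE : ((z - x) * (z + x) = p * y ^ 2)%N.
  by rewrite -subn_sqr xyz addKn.
have xz_coprime : coprime (z - x) (z + x).
  rewrite /coprime -(gcdnDl (z - x)).
  have -> : ((z - x) + (z + x) = 2 ^ m.+2)%N by rewrite [(2 ^ _)%N]expnS -/z; lia.
  by rewrite -/(coprime _ _) coprimeXr // coprimen2; lia.
have [u [v uv]] := coprime_mul_sqr p_pr xz_coprime xzE.
have uv_odd : odd u && odd v.
  have : odd (z - x) && odd (z + x) by clear - x_odd z_even xz; lia.
  by case: uv => -[-> ->]; rewrite !(oddX, oddM) /=; case: (odd u); case: (odd v); rewrite ?andbF.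
have uvE : (p * u ^ 2 + v ^ 2 = 4 * 2 ^ m)%N.
  have -> : (4 * 2 ^ m = (z - x) + (z + x))%N.
    by rewrite addnCA subnK ?(ltnW xz) // addnn -mul2n /z expnS mulnA.
  by case: uv => -[-> ->] //; rewrite addnC.
(* As [u] and [v] are odd, the first witness is exactly [(v - u) / 2], so [2 * c' + d' = v] and four
   times the new norm is [v ^ 2 + p * u ^ 2]. *)
exists (v./2%:Z - u./2%:Z), u%:Z; split.
  by rewrite dvdzE dvdn2 negbK; case/andP: uv_odd.
have vE : v%:Z = 2 * (v./2%:Z - u./2%:Z) + u%:Z by clear -uv_odd; lia.
have := congr1 Posz uvE; rewrite -!mulnn PoszD !PoszM -[Posz (2 ^ m)]natz natrX natz.
rewrite vE pk => E; apply: (@mulfI int 4) => //; rewrite -E; ring.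
Qed.

(** * Powers of a prime above 2 in a quadratic order *)

Section QuadraticOrder.
Variables (R : comNzRingType) (k : int) (w : R).
Hypothesis w_sqr : w * w = w - k%:~R.
Hypothesis w_span : forall x : R, exists a b : int, x = a%:~R + b%:~R * w.
Hypothesis w_free : forall a b : int, a%:~R + b%:~R * w = 0 -> a = 0 /\ b = 0.
Hypothesis R_domain : forall x y : R, x * y = 0 -> x = 0 \/ y = 0.

Lemma quadratic_inj (a b c d : int) :
  a%:~R + b%:~R * w = c%:~R + d%:~R * w -> a = c /\ b = d.
Proof.
move=> /eqP; rewrite -subr_eq0 => /eqP E; have [] := @w_free (a - c) (b - d).
  by rewrite -E; ring.
by move=> /subr0_eq-> /subr0_eq->.
Qed.

(* The ideal [(2^n, w - r)]; it is the [n]-th power of the prime [(2, w)] when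
   [r] is even and is a root of [X^2 - X + k] modulo [2^n]. *)
Definition root_ideal (r : int) (n : nat) : set R :=
  [set x | exists c b : int, x = (2 ^+ n * c)%:~R + b%:~R * (w - r%:~R)].

(** With [r = 2 * s], the square of [w - r] is [(1 - 2 * r) * (w - r) - 2 ^+ n.+1 * t]. Since
    [1 - 2 * r] is odd, subtracting multiples of 2 recovers [w - r] itself inside the product. *)
Lemma root_ideal_mul (s t : int) n :
  (2 * s) ^+ 2 - 2 * s + k = 2 ^+ n.+1 * t ->
  ideal_mul (root_ideal (2 * s) 1) (root_ideal (2 * s) n)
    = root_ideal (2 * s) n.+1.
Proof.
move=> rt; have kE : k = 2 ^+ n.+1 * t - (2 * s) ^+ 2 + 2 * s by rewrite -rt; ring.
apply/seteqP; split=> [x [m [f [g [fI gI ->]]]]|x [c [b ->]]].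
  apply: (big_ind (root_ideal (2 * s) n.+1)).
  - by exists 0, 0; rewrite mulr0 mul0r addr0.
  - move=> _ _ [c [b ->]] [c' [b' ->]]; exists (c + c'), (b + b'); ring.
  - move=> i _; have [c [b ->]] := fI i; have [c' [b' ->]] := gI i.
    exists (c * c' - b * b' * t), (2 * c * b' + 2 ^+ n * c' * b + b * b' * (1 - 4 * s)).
    by move: w_sqr; rewrite kE exprS => w2; ring: w2.
exists 2%N.
exists (fun i => if i == ord0 then 2 else w - (2 * s)%:~R).
exists (fun i => if i == ord0
  then (2 ^+ n * (c + b * t))%:~R + (b * (2 * s))%:~R * (w - (2 * s)%:~R)
  else b%:~R * (w - (2 * s)%:~R)).
split.
- move=> i; case: ifP => _; first by exists 1, 0; rewrite mulr1 mul0r addr0.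
  by exists 0, 1; rewrite mulr0 mul1r add0r.
- move=> i; case: ifP => _; first by exists (c + b * t), (b * (2 * s)).
  by exists 0, b; rewrite mulr0 add0r.
- rewrite !big_ord_recl big_ord0 /=.
  by move: w_sqr; rewrite kE exprS => w2; ring: w2.
Qed.

Lemma root_ideal_exp (s t : int) n : (2 * s) ^+ 2 - 2 * s + k = 2 ^+ n * t ->
  ideal_exp (root_ideal (2 * s) 1) n = root_ideal (2 * s) n.
Proof.
elim: n t => [|n IHn] t rt.
  apply/seteqP; split=> // x _; have [a [b ->]] := w_span x.
  exists (a + b * (2 * s)), b; ring.
rewrite /ideal_exp iterS -/(ideal_exp _ n) (IHn (2 * t)); last by rewrite rt exprS; ring.
exact: root_ideal_mul rt.
Qed.

(** The divisibility puts [g = c + d w] in the ideal, and its norm equals the index [2 ^+ n] of the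
    ideal, so [g] generates it. *)
Lemma root_ideal_principal (r t : int) n (c d : int) :
  r ^+ 2 - r + k = 2 ^+ n * t -> c ^+ 2 + c * d + k * d ^+ 2 = 2 ^+ n ->
  (2 ^+ n %| c + d * r)%Z -> same_ideal_class (root_ideal r n) setT.
Proof.
move=> rt cd /dvdzP[q cE]; have kE : k = 2 ^+ n * t - r ^+ 2 + r by rewrite -rt; ring.
have {cE q}[q cE] : exists q : int, c = 2 ^+ n * q - d * r.
  by exists q; rewrite mulrC -cE; ring.
have n0 : 2 ^+ n != 0 :> int by rewrite expf_eq0 andbF.
pose g : R := c%:~R + d%:~R * w.
have gN : g * ((c + d)%:~R - d%:~R * w) = (2 ^+ n)%:~R.
  by rewrite -cd /g; ring: w_sqr.
have dom2 (x : R) : (2 ^+ n)%:~R * x = 0 -> x = 0.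
  case/R_domain=> // E; have [] := @w_free (2 ^+ n) 0; first by rewrite mul0r addr0.
  by move/eqP: n0.
exists 1, g; split; first exact: oner_neq0.
  apply/eqP=> g0; have [] := @w_free (2 ^+ n) 0; last by move/eqP: n0.
  by rewrite -gN g0 !mul0r addr0.
apply/seteqP; split=> [_ [x [a [b ->]] <-]|_ [x _ <-]].
  (* The quotient of the given element by [g]: its product with the conjugate [c + d - d w], divided
     by [2 ^+ n]. *)
  pose y : R := (a * (c + d) + b * (d * t - r * q))%:~R + (b * q - a * d)%:~R * w.
  exists y => //; apply/eqP; rewrite -subr_eq0; apply/eqP/dom2.
  have xy : ((2 ^+ n * a)%:~R + b%:~R * (w - r%:~R)) * ((c + d)%:~R - d%:~R * w)
      = (2 ^+ n)%:~R * y.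
    by rewrite /y cE; move: w_sqr; rewrite kE => w2; ring: w2.
  by rewrite mulrBr mulrCA -xy -gN; ring.
have [a [b ->]] := w_span x.
exists (g * (a%:~R + b%:~R * w)); last by rewrite mul1r.
exists (a * q + b * (r * q - d * t)), (a * d + b * c + b * d).
by rewrite /g cE; move: w_sqr; rewrite kE => w2; ring: w2.
Qed.

(* The generator is [c + d w]; the last equation says that it is primitive. *)
Lemma root_ideal_generator (r t : int) n :
  0 < k -> r ^+ 2 - r + k = 2 ^+ n * t ->
  same_ideal_class (root_ideal r n) setT ->
  exists c d e f : int,
    c ^+ 2 + c * d + k * d ^+ 2 = 2 ^+ n /\ (c + d) * f + d * e = 1.
Proof.
move=> k_gt0 rt [a [b [a0 b0 ab]]].
have kE : k = 2 ^+ n * t - r ^+ 2 + r by rewrite -rt; ring.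
have [g gI bE] : ideal_scale a (root_ideal r n) b.
  by rewrite ab; exists 1; rewrite ?mulr1.
have gen x : root_ideal r n x -> exists y, x = g * y.
  move=> xI; have : ideal_scale b setT (a * x) by rewrite -ab; exists x.
  case=> y _; rewrite -bE => E; exists y; apply/eqP; rewrite -subr_eq0; apply/eqP.
  case: (@R_domain a (x - g * y)) => //; last by move/eqP: a0.
  by rewrite mulrBr -E; ring.
have [c0 [d gE]] := gI.
pose c := 2 ^+ n * c0 - d * r.
have {}gE : g = c%:~R + d%:~R * w by rewrite gE /c; ring.
have [y1] : exists y, (2 ^+ n)%:~R + 0%:~R * w = g * y.
  by apply: gen; exists 1, 0; ring.
have [u [h ->]] := w_span y1 => E1.
have [y2] : exists y, (- r)%:~R + 1%:~R * w = g * y.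
  by apply: gen; exists 0, 1; ring.
have [e [f ->]] := w_span y2 => E2.
have mulE u' h' : (c%:~R + d%:~R * w) * (u'%:~R + h'%:~R * w)
    = (c * u' - d * h' * k)%:~R + (c * h' + d * u' + d * h')%:~R * w :> R.
  by ring: w_sqr.
move: E1 E2; rewrite gE !mulE => /quadratic_inj[E1 E1'] /quadratic_inj[_ E2].
exists c, d, e, f; split; last by rewrite E2; ring.
set N := _ + k * _.
(* Determinants: multiplication by [g] has determinant [N] and sends the lattice basis [y1], [y2] to
   [2 ^+ n], [w - r]. Conversely [2 ^+ n] divides [N], because [g] lies in the ideal. *)
have NM : N * (u * f - h * e) = 2 ^+ n.
  have Nu : N * u = 2 ^+ n * (c + d).
    by rewrite E1 /N -[RHS]addr0 -(mulr0 (k * d)) E1'; ring.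
  have Nh : N * h = - (2 ^+ n * d).
    by rewrite E1 /N -[RHS]addr0 -(mulr0 c) E1'; ring.
  have -> : N * (u * f - h * e) = (N * u) * f - (N * h) * e by ring.
  rewrite Nu Nh -[RHS]mulr1 E2; ring.
have n0 : 2 ^+ n > 0 :> int by rewrite exprn_gt0.
have Nn : N = 2 ^+ n * (2 ^+ n * c0 ^+ 2 - 2 * c0 * d * r + c0 * d + d ^+ 2 * t).
  by rewrite /N /c kE; ring.
have N_ge0 : 0 <= N.
  rewrite -(pmulr_rge0 _ (ltr0Sn int 3)).
  have -> : 4 * N = (2 * c + d) ^+ 2 + (4 * k - 1) * d ^+ 2 by rewrite /N; ring.
  by rewrite addr_ge0 ?sqr_ge0 // mulr_ge0 ?sqr_ge0 //; lia.
move: Nn NM; set q := (X in N = _ * X -> _) => Nn NM.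
have qM : q * (u * f - h * e) = 1.
  by apply: (mulfI (lt0r_neq0 n0)); rewrite mulrA -Nn NM mulr1.
have q_ge0 : 0 <= q by rewrite -(pmulr_rge0 _ n0) -Nn.
have q1 : q = 1.
  have : (q %| 1)%Z by apply/dvdzP; exists (u * f - h * e); rewrite mulrC.
  by rewrite dvdz1 => /eqP q1; rewrite -(gez0_abs q_ge0) q1.
by rewrite Nn q1 mulr1.
Qed.

(** All even [r] give the same ideal at exponent 1. Hence [s] can be chosen after [L], and one root
    modulo [2 ^+ L.+1] serves every exponent up to [L]. *)
Lemma ideal_class_order_odd (p : nat) (I : set R) (L : nat) :
  prime p -> p%:Z = 4 * k - 1 -> (2 %| k)%Z -> (8 < p)%N ->
  (forall s : int, I = root_ideal (2 * s) 1) ->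
  ideal_class_order I L -> odd L /\ L != 1%N.
Proof.
move=> p_pr pk k2 p8 IE [L0 L_princ L_min].
have k_gt0 : 0 < k by lia.
have [s [t rt]] := even_root L k2; rewrite (IE s) in L_princ L_min.
have rn n : (n <= L)%N -> (2 * s) ^+ 2 - 2 * s + k = 2 ^+ n * (2 ^+ (L.+1 - n) * t).
  by move=> nL; rewrite rt mulrA -exprD subnKC // leqW.
rewrite (root_ideal_exp (rn L _)) // in L_princ.
have [c [d [e [f [cd ef]]]]] := root_ideal_generator k_gt0 (rn L (leqnn L)) L_princ.
split; last first.
  apply/eqP=> L1; rewrite L1 expr1 in cd.
  have : (2 * c + d) ^+ 2 + p%:Z * d ^+ 2 = 8.
    by transitivity (4 * (c ^+ 2 + c * d + k * d ^+ 2)); [rewrite pk; ring | rewrite cd].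
  have [->|d0] := eqVneq d 0.
    rewrite expr0n mulr0 !addr0 => {}cd; clear -cd.
    by have [|] := leP `|c| 1; nia.
  have : 1 <= d ^+ 2 by rewrite -gtz0_ge1 lt0r sqr_ge0 expf_neq0.
  by move: (sqr_ge0 (2 * c + d)); move: (_ ^+ 2) (_ ^+ 2) => x y; clear -p8; nia.
apply/negPn/negP=> L_even; pose m := L./2.
have LE : L = (2 * m)%N by rewrite /m; lia.
have m0 : (0 < m)%N by lia.
have mL : (m < L)%N by lia.
rewrite LE in cd; have [a [b [b_odd ab]]] := norm_form_sqrt p_pr pk k2 m0 cd ef.
have := rn m (ltnW mL); set r := 2 * s; set t' := _ * t => rm.
(* The factors are the values at [r] of [a + b w] and of its conjugate. Their difference has the
   parity of [b], so they are not both even and [2 ^+ m] divides one of them. *)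
have prod : (2 ^+ m %| (a + b * r) * (a + b - b * r))%Z.
  apply/dvdzP; exists (1 - b ^+ 2 * t').
  have -> : (1 - b ^+ 2 * t') * 2 ^+ m = 2 ^+ m - b ^+ 2 * (2 ^+ m * t') by ring.
  by rewrite -rm -ab; ring.
have coprime2 (x : int) : ~~ (2 %| x)%Z -> coprimez (2 ^+ m) x.
  by rewrite coprimez_pexpl // coprimezE coprime2n dvdzE dvdn2 negbK.
apply: (L_min m); first by rewrite m0.
rewrite (root_ideal_exp rm).
have [r1|r1] := boolP (2 %| a + b * r)%Z.
  apply: (root_ideal_principal rm ab).
  suff r2 : ~~ (2 %| a + b - b * r)%Z by rewrite -(Gauss_dvdzl _ (coprime2 _ r2)).
  apply: contra b_odd => r2; have -> : b = (a + b - b * r) - (a + b * r) + 2 * (2 * s * b).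
    by rewrite /r; ring.
  by apply: rpredD; [exact: rpredB | exact: dvdz_mulr].
(* Here the conjugate [a + b - b w] is the generator. *)
apply: (root_ideal_principal (c := a + b) (d := - b) rm); first by rewrite -ab; ring.
by rewrite mulNr -(Gauss_dvdzr _ (coprime2 _ r1)).
Qed.

End QuadraticOrder.

(** * The ring of integers as [Z[(1 + s) / 2]] *)

Section RingOfIntegers.
Variables (p : nat) (k : int).
Hypotheses (p_prime : prime p) (pk : p%:Z = 4 * k - 1).

Let s : algC := sqrtC (- p%:R).
Let s_sqr : s * s = - p%:R.
Proof. by rewrite -expr2 sqrtCK. Qed.

Let p_algC : p%:R = 4 * k%:~R - 1 :> algC.
Proof.
by rewrite -[p%:R]/((p%:Z)%:~R) pk; ring.
Qed.

Let conj_s : s^* = - s.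
Proof.
have : (s^* - s) * (s^* + s) = 0.
  have -> : (s^* - s) * (s^* + s) = s^* * s^* - s * s by ring.
  by rewrite -rmorphM s_sqr rmorphN rmorph_nat subrr.
(* If [s] were real, its square [- p] would be nonnegative. *)
move=> /eqP; rewrite mulf_eq0 => /orP[/eqP/subr0_eq/CrealP s_real|]; last first.
  by rewrite addr_eq0 => /eqP.
have := @real_exprn_even_ge0 _ 2 s s_real isT.
by rewrite sqrtCK oppr_ge0 lern0 => /eqP p0; move: p_prime; rewrite p0.
Qed.

Lemma quad_gen_subproof : (1 + s) / 2 \in quad_int_pred p.
Proof.
rewrite inE /=; apply/andP; split; last first.
  apply/quad_fieldP; exists (1 / 2), (1 / 2).
  by rewrite -/s fmorph_div rmorph1 rmorph_nat; field.
pose q : {poly int} := 'X^2 - ('X - k%:P).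
have q_monic : q \is monic.
  by apply/monicP; rewrite lead_coefDl ?lead_coefXn // size_polyN size_XsubC size_polyXn.
apply: (@root_monic_Aint (map_poly intr q)); first last.
- by apply/polyOverP=> i; rewrite coef_map intr_int.
- exact: monic_map.
apply/rootP; rewrite /q !rmorphB /= map_polyXn map_polyX map_polyC /= !hornerE.
by have sE := s_sqr; rewrite p_algC in sE; field: sE.
Qed.

Definition quad_gen : quad_int p := QuadInt quad_gen_subproof.

Lemma quad_val_lin (a b : int) :
  val (a%:~R + b%:~R * quad_gen) = a%:~R + b%:~R * ((1 + s) / 2).
Proof. by rewrite rmorphD rmorphM !rmorph_int. Qed.

Lemma quad_gen_sqr : quad_gen * quad_gen = quad_gen - k%:~R.
Proof.
apply: val_inj; rewrite rmorphM rmorphB rmorph_int /=.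
by have sE := s_sqr; rewrite p_algC in sE; field: sE.
Qed.

Lemma quad_gen_free (a b : int) : a%:~R + b%:~R * quad_gen = 0 -> a = 0 /\ b = 0.
Proof.
move=> /(congr1 val); rewrite quad_val_lin rmorph0 => E.
have : ((2 * a + b) ^+ 2 + p%:Z * b ^+ 2)%:~R = 0 :> algC.
  transitivity (4 * (a%:~R + b%:~R * ((1 + s) / 2)) * (a%:~R + b%:~R - b%:~R * ((1 + s) / 2))).
    by rewrite pk; have sE := s_sqr; rewrite p_algC in sE; field: sE.
  by rewrite E mulr0 mul0r.
have p0 : 0 < p%:Z by rewrite ltz_nat prime_gt0.
move/(intr_inj (x2 := 0)) => /eqP.
rewrite paddr_eq0; [|exact: sqr_ge0|exact: mulr_ge0 (ltW p0) (sqr_ge0 b)].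
by rewrite !(expf_eq0, mulf_eq0) /= (gt_eqF p0) /= => /andP[/eqP ab /eqP b0]; lia.
Qed.

Lemma quad_int_domain (x y : quad_int p) : x * y = 0 -> x = 0 \/ y = 0.
Proof.
move=> /(congr1 val)/eqP; rewrite rmorphM mulf_eq0.
by case/orP=> /eqP E; [left|right]; apply: val_inj.
Qed.

(** For [x = a + b s], trace and norm are rational algebraic integers, hence integers. They force
    [2 * a] and [2 * b] to be integers of the same parity. *)
Lemma quad_gen_span (x : quad_int p) :
  exists a b : int, x = a%:~R + b%:~R * quad_gen.
Proof.
have xP := valP x; move: xP; rewrite inE /= => /andP[xA /quad_fieldP[a [b xE]]].
rewrite -/s -[quad_int_val x]/(val x) in xA xE.
have conj_ratr (q : rat) : (ratr q : algC)^* = ratr q by rewrite conj_Crat ?Crat_rat.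
have conj_x : (val x)^* = ratr a - ratr b * s.
  by rewrite xE rmorphD /= conj_ratr rmorphM /= conj_ratr conj_s mulrN.
have sA : s \in Aint.
  have -> : s = 2 * ((1 + s) / 2) - 1 by field.
  have wA : (1 + s) / 2 \in Aint by move: quad_gen_subproof; rewrite inE => /andP[].
  by apply: rpredB; [apply: rpredM => //; rewrite Aint_Cint ?intr_nat | exact: Aint1].
have int_of (q : rat) : ratr q \in Aint -> exists n : int, ratr q = n%:~R :> algC.
  by move=> qA; apply/intrP; exact: Cint_rat_Aint (Crat_rat q) qA.
have conjA : (val x)^* \in Aint by rewrite Aint_aut.
have [t tE] : exists t : int, ratr (2 * a) = t%:~R :> algC.
  apply: int_of; have -> : ratr (2 * a) = val x + (val x)^* :> algC.
    by rewrite conj_x xE rmorphM rmorph_nat; ring.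
  by rewrite rpredD.
have [n nE] : exists n : int, ratr (a ^+ 2 + p%:R * b ^+ 2) = n%:~R :> algC.
  apply: int_of; have -> : ratr (a ^+ 2 + p%:R * b ^+ 2) = val x * (val x)^* :> algC.
    rewrite conj_x xE rmorphD rmorphM !rmorphXn rmorph_nat.
    by have sE := s_sqr; ring: sE.
  by rewrite rpredM.
(* Integrality of [2 * p * b] comes first; [tvn] below then shows that [p] divides it, so [2 * b] is
   an integer [u]. *)
have [v vE] : exists v : int, ratr (2 * p%:R * b) = v%:~R :> algC.
  apply: int_of; have -> : ratr (2 * p%:R * b) = - s * (val x - (val x)^*) :> algC.
    rewrite conj_x xE !rmorphM !rmorph_nat.
    by have sE := s_sqr; ring: sE.
  by apply: rpredM; [rewrite rpredN | apply: rpredB].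
move: tE nE vE; rewrite -!(ratr_int algC) => /fmorph_inj tE /fmorph_inj nE /fmorph_inj vE.
have tvn : p%:Z * t ^+ 2 + v ^+ 2 = 4 * p%:Z * n.
  apply: (@intr_inj rat); rewrite !(rmorphXn, rmorphD, rmorphM) /= -tE -nE -vE; ring.
have p0 : p%:R != 0 :> rat by rewrite pnatr_eq0 -lt0n prime_gt0.
have [u uE] : exists u : int, v = p%:Z * u.
  have : (p%:Z %| v * v)%Z.
    have -> : v * v = p%:Z * (4 * n - t ^+ 2) by rewrite mulrBr mulrA [p%:Z * 4]mulrC -tvn; ring.
    exact: dvdz_mulr.
  rewrite !dvdzE abszM Euclid_dvdM // orbb => pv.
  have /dvdzP[u ->] : (p%:Z %| v)%Z by rewrite dvdzE.
  by exists u; rewrite mulrC.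
have bE : 2 * b = u%:~R.
  apply: (mulfI p0); rewrite mulrA [p%:R * 2]mulrC vE uE rmorphM /=; ring.
have tun : t ^+ 2 + p%:Z * u ^+ 2 = 4 * n.
  apply: (@mulfI _ p%:Z); first by rewrite -lt0n prime_gt0.
  by rewrite [RHS]mulrCA mulrA -tvn uE; ring.
have [c cE] : exists c : int, t = u + 2 * c.
  (* Modulo 4, [p] is [-1], so [t ^+ 2] and [u ^+ 2] agree there, and [t], [u] have the same
     parity. *)
  have : (2 %| (t - u) * (t - u))%Z.
    have -> : (t - u) * (t - u) = 2 * (2 * (n - k * u ^+ 2) + u ^+ 2 - t * u).
      have t2 : t ^+ 2 = 4 * n - 4 * k * u ^+ 2 + u ^+ 2 by rewrite -tun pk; ring.
      by transitivity (t ^+ 2 - 2 * t * u + u ^+ 2); [|rewrite t2]; ring.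
    exact: dvdz_mulr.
  rewrite dvdz2M orbb => /dvdzP[c tu].
  by exists c; rewrite [2 * c]mulrC -tu; ring.
exists c, u; apply: val_inj; rewrite quad_val_lin.
have aE : a = t%:~R / 2 by rewrite -tE; field.
have {}bE : b = u%:~R / 2 by rewrite -bE; field.
have half (z : int) : ratr (z%:~R / 2) = z%:~R / 2 :> algC.
  by rewrite fmorph_div /= ratr_int rmorph_nat.
by rewrite xE aE bE cE !half; field.
Qed.

End RingOfIntegers.

(** As [g * (1 - g) = k] is even, primality puts [g] or [1 - g] in [P]. Both satisfy the same
    quadratic equation and complete 1 to a basis, so either can serve as [w]. *)
Lemma prime_above_2_order (p : nat) (P : prime_idealr (quad_int p)) (L : nat) :
  prime p -> p = 7 %[mod 8] -> (8 < p)%N -> 2%:R \in P ->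
  ideal_class_order [set` P] L -> odd L /\ L != 1%N.
Proof.
move=> p_pr p7 p8 P2 ord_L.
have [l pl] : exists l : nat, (p.+1 = 8 * l)%N by exists (p.+1 %/ 8)%N; lia.
pose k : int := 2 * l%:Z.
have pk : p%:Z = 4 * k - 1 by rewrite /k; lia.
have k2 : (2 %| k)%Z by exact: dvdz_mulr.
have P1 : 1 \in P = false by exact: idealr1.
suff [w [wP w_sqr w_span w_free]] : exists w : quad_int p, [/\ w \in P,
    w * w = w - k%:~R, forall x, exists a b : int, x = a%:~R + b%:~R * w &
    forall a b : int, a%:~R + b%:~R * w = 0 -> a = 0 /\ b = 0].
  apply: (ideal_class_order_odd w_sqr w_span w_free (@quad_int_domain p) p_pr pk k2 p8) ord_L.
  move=> s; apply/seteqP; split=> [x xP|_ [c [b ->]]] /=.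
    have [a [b xE]] := w_span x; rewrite xE in xP *.
    have aP : a%:~R \in P.
      have -> : a%:~R = (a%:~R + b%:~R * w) - b%:~R * w by rewrite addrK.
      by apply: rpredB => //; apply: idealMr.
    have [/dvdzP[c ->]|a_odd] := boolP (2 %| a)%Z.
      by exists (c + b * s), b; ring.
    (* An odd [a] in [P], together with 2, would put 1 in [P]. *)
    have [c aE] : exists c : int, a = 1 + c * 2 by exists ((a - 1) %/ 2)%Z; lia.
    have : 1 \in P; last by rewrite P1.
    have -> : 1 = a%:~R - c%:~R * 2 :> quad_int p by rewrite aE; ring.
    by apply: rpredB => //; apply: idealMr.
  have -> : (2 ^+ 1 * c)%:~R + b%:~R * (w - (2 * s)%:~R)
      = b%:~R * w + (c - b * s)%:~R * 2 :> quad_int p by ring.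
  by apply: rpredD; apply: idealMr.
have g_sqr := quad_gen_sqr pk; have g_span := quad_gen_span p_pr pk.
have g_free := @quad_gen_free p k p_pr pk; set g := quad_gen pk in g_sqr g_span g_free.
have : g * (1 - g) \in P.
  have -> : g * (1 - g) = l%:R * 2 by rewrite mulrBr mulr1 g_sqr /k; ring.
  exact: idealMr.
rewrite prime_idealrM => /orP[gP|gP]; first by exists g.
exists (1 - g); split=> //.
- by transitivity (1 - 2 * g + g * g); [|rewrite g_sqr]; ring.
- by move=> x; have [a [b ->]] := g_span x; exists (a + b), (- b); ring.
- move=> a b E; have [] := g_free (a + b) (- b); first by rewrite -E; ring.
  by lia.
Qed.

Section Graphs.
Local Open Scope nat_scope.

(** * Walks and distances in graphs *)

Section Walks.
Variables (V : finType) (e : rel V).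

Lemma has_walk0 x : has_walk e x x 0.
Proof. by exists [::]. Qed.

Lemma has_walk1 x y : e x y -> has_walk e x y 1.
Proof. by move=> exy; exists [:: y]; split=> //=; rewrite exy. Qed.

Lemma has_walk_trans y x z m n :
  has_walk e x y m -> has_walk e y z n -> has_walk e x z (m + n).
Proof.
move=> [s [<- es <-]] [t [<- et <-]]; exists (s ++ t).
by rewrite size_cat cat_path last_cat es et.
Qed.

Lemma has_walk_sym x y n : symmetric e -> has_walk e x y n -> has_walk e y x n.
Proof.
move=> e_sym [s [<-]]; elim: s x => [|z s IHs] x /=.
  by move=> _ <-; apply: has_walk0.
move=> /andP[exz es] sy; rewrite -addn1.
by apply: has_walk_trans (IHs _ es sy) (has_walk1 _); rewrite e_sym.
Qed.

(** The source of lower bounds on distances: a potential rising by at most 1 per edge bounds the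
    length of every walk from below. *)
Lemma has_walk_lipschitz (f : V -> nat) x y n :
  (forall u v, e u v -> f v <= f u + 1) -> has_walk e x y n -> f y <= f x + n.
Proof.
move=> f_lip [s [<-]]; elim: s x => [|z s IHs] x /=.
  by move=> _ <-; rewrite addn0.
move=> /andP[exz es] sy; have := f_lip _ _ exz; have := IHs z es sy; lia.
Qed.

Lemma has_walk_distance x y n :
  has_walk e x y n -> exists2 m, graph_distance e x y m & m <= n.
Proof.
move=> wn; have ex : exists m, `[< has_walk e x y m >] by exists n; apply/asboolP.
case: (ex_minnP ex) => m /asboolP wm m_min; exists m.
  by split=> // i wi; apply/m_min/asboolP.
by apply/m_min/asboolP.
Qed.

End Walks.

Lemma has_walk_homo (V W : finType) (e : rel V) (e' : rel W) (f : V -> W) x y n :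
  (forall u v, e u v -> e' (f u) (f v)) ->
  has_walk e x y n -> has_walk e' (f x) (f y) n.
Proof.
move=> f_homo [s [<- es <-]]; exists (map f s).
rewrite size_map last_map path_map; split=> //; exact: sub_path es.
Qed.

Lemma stacked_arcP L u v :
  reflect [\/ exists2 i, i < L & u = 2 * i /\ v = 2 * i + 1,
              exists2 i, i.+1 < L & u = 2 * i + 1 /\ v = 2 * i + 3 |
              u = 2 * L - 1 /\ v = 1]
    (stacked_arc L u v).
Proof.
apply: (iffP or3P) => [[/existsP[i /andP[/eqP-> /eqP->]]||/andP[/eqP-> /eqP->]]|].
- by constructor 1; exists i.
- move=> /existsP[i /andP[/eqP-> /eqP->]]; constructor 2; exists i => //.
  by have := ltn_ord i; lia.
- by constructor 3.
move=> [[i iL [-> ->]]|[i iL [-> ->]]|[-> ->]].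
- by constructor 1; apply/existsP; exists (Ordinal iL); rewrite /= !eqxx.
- have iL1 : i < L - 1 by lia.
  by constructor 2; apply/existsP; exists (Ordinal iL1); rewrite /= !eqxx.
- by constructor 3; rewrite !eqxx.
Qed.

Lemma stacked_adj_sym L : symmetric (@stacked_adj L).
Proof. by move=> u v; rewrite /stacked_adj orbC. Qed.

(** * Distances in stacked components with an odd cycle *)

Section OddStacked.
Variable h : nat.
Hypothesis h_gt0 : 0 < h.
Let L := h.*2.+1.
Local Notation e := (@stacked_adj L).

Lemma stacked_ascent i d (x y : 'I_(2 * L)) :
  x = 2 * i + 1 :> nat -> y = 2 * (i + d) + 1 :> nat -> has_walk e x y d.
Proof.
elim: d y => [|d IHd] y xE yE.
  by have -> : y = x by [apply: val_inj; rewrite /= xE yE addn0]; apply: has_walk0.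
have zL : 2 * (i + d) + 1 < 2 * L by have := ltn_ord y; lia.
rewrite -[d.+1]addn1; apply: (has_walk_trans (IHd (Ordinal zL) xE erefl)).
apply/has_walk1/orP; left; apply/stacked_arcP; constructor 2.
by exists (i + d); have := ltn_ord y; rewrite ?yE /=; lia.
Qed.

Lemma stacked_odd_walk (x y : 'I_(2 * L)) :
  odd x -> odd y -> exists2 n, has_walk e x y n & n <= h.
Proof.
wlog: x y / x <= y.
  move=> wlog_xy ox oy; have [xy|/ltnW yx] := leqP x y; first exact: wlog_xy.
  have [n w nh] := wlog_xy y x yx oy ox.
  by exists n => //; apply: has_walk_sym w; apply: stacked_adj_sym.
move=> xy ox oy.
have xE : x = 2 * x./2 + 1 :> nat by lia.
have yE : y = 2 * (x./2 + (y./2 - x./2)) + 1 :> nat by lia.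
have [short|long] := leqP (y./2 - x./2) h.
  by exists (y./2 - x./2) => //; apply: stacked_ascent xE yE.
(* More than [h] steps apart, the other way round through the closing edge takes [L - (y./2 - x./2)]
   steps, at most [h] since [L = 2h + 1]. *)
have yL := ltn_ord y.
have fL : 1 < 2 * L by lia.
have lL : 2 * L - 1 < 2 * L by lia.
pose f := Ordinal fL; pose l := Ordinal lL.
have fx : has_walk e x f x./2.
  by apply/(has_walk_sym (@stacked_adj_sym L))/(@stacked_ascent 0).
have yl : has_walk e l y (h.*2 - y./2).
  apply/(has_walk_sym (@stacked_adj_sym L))/(@stacked_ascent y./2) => /=; lia.
have fl : has_walk e f l 1.
  by apply/has_walk1/orP; right; apply/stacked_arcP; constructor 3.
by exists (x./2 + 1 + (h.*2 - y./2));
  [exact: has_walk_trans (has_walk_trans fx fl) yl | lia].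
Qed.

Lemma stacked_to_ring (x : 'I_(2 * L)) :
  exists2 y : 'I_(2 * L), odd y & exists2 n, has_walk e x y n & n <= 1.
Proof.
have [ox|ex] := boolP (odd x).
  by exists x => //; exists 0 => //; apply: has_walk0.
have yL : x.+1 < 2 * L by have := ltn_ord x; lia.
exists (Ordinal yL) => //=; exists 1 => //.
apply/has_walk1/orP; left; apply/stacked_arcP; constructor 1.
by exists x./2; have := ltn_ord x; rewrite /=; lia.
Qed.

Lemma stacked_walk (x y : 'I_(2 * L)) :
  exists2 n, has_walk e x y n & n <= h + 2.
Proof.
have [x' ox' [i wi i1]] := stacked_to_ring x.
have [y' oy' [j wj j1]] := stacked_to_ring y.
have [n w nh] := stacked_odd_walk ox' oy'.
exists (i + n + j); last by lia.
apply: has_walk_trans (has_walk_trans wi w) _.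
by apply: has_walk_sym wj; apply: stacked_adj_sym.
Qed.

(** Subtraction is truncated, so one of [i - j], [j - i] vanishes and their sum is the absolute
    difference. *)
Definition cycle_dist (n i j : nat) : nat :=
  minn ((i - j) + (j - i)) (n - ((i - j) + (j - i))).

Lemma cycle_dist_step i i' j : i < L -> i' < L -> j < L ->
    i' = i.+1 \/ i = h.*2 /\ i' = 0 ->
  cycle_dist L i' j <= cycle_dist L i j + 1 /\
  cycle_dist L i j <= cycle_dist L i' j + 1.
Proof. by rewrite /cycle_dist /L => iL i'L jL [E|[E E']]; split; lia. Qed.

(* [v./2] is the position on the odd cycle of [v] or of its only neighbour. *)
Definition floor_dist (f v : nat) : nat :=
  if v == f then 0 else cycle_dist L v./2 f./2 + 1 + ~~ odd v.

Lemma floor_dist_adj (f v w : 'I_(2 * L)) : ~~ odd f -> e v w ->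
  floor_dist f w <= floor_dist f v + 1 /\ floor_dist f v <= floor_dist f w + 1.
Proof.
move=> ef; have fL := ltn_ord f.
suff arc u u' : stacked_arc L u u' ->
    floor_dist f u' <= floor_dist f u + 1 /\ floor_dist f u <= floor_dist f u' + 1.
  by case/orP=> /arc[].
have f2L : f./2 < L by lia.
move=> /stacked_arcP[[i iL [-> ->]]|[i iL [-> ->]]|[-> ->]]; rewrite /floor_dist.
- have -> : (2 * i)./2 = i by lia.
  have -> : (2 * i + 1)./2 = i by lia.
  case: (2 * i + 1 =P f :> nat) => [E|_]; first by lia.
  case: (2 * i =P f :> nat) => [E|_]; last by lia.
  by have -> : f./2 = i by [lia]; rewrite /cycle_dist subnn; lia.
- have -> : (2 * i + 1)./2 = i by lia.
  have -> : (2 * i + 3)./2 = i.+1 by lia.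
  have [] := @cycle_dist_step i i.+1 f./2 (ltnW iL) iL f2L (or_introl erefl).
  by do 2 (case: eqP => [E|_]; first by lia); lia.
- have -> : (2 * L - 1)./2 = h.*2 by lia.
  have [] := @cycle_dist_step h.*2 0 f./2 (ltnSn _) isT f2L (or_intror (conj erefl erefl)).
  by do 2 (case: eqP => [E|_]; first by lia); rewrite /=; lia.
Qed.

(** The extremal vertex is a floor vertex [h] positions away on the cycle; a label shift of [h.*2]
    moves the position by [h]. It differs from [f] because [h] is positive. *)
Lemma floor_dist_max (f : 'I_(2 * L)) : ~~ odd f ->
  exists v : 'I_(2 * L), floor_dist f v = h + 2.
Proof.
move=> ef; have fL := ltn_ord f.
have [fh|fh] := leqP f./2 h.
  have vL : f + h.*2 < 2 * L by lia.
  exists (Ordinal vL); rewrite /floor_dist /cycle_dist /=; case: eqP => ?; lia.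
have vL : f - h.*2 < 2 * L by lia.
exists (Ordinal vL); rewrite /floor_dist /cycle_dist /=; case: eqP => ?; lia.
Qed.

Lemma labelled_walk (V : finType) (eV : rel V) (lab : V -> 'I_(2 * L)) x y :
  stacked_labelling eV lab -> exists2 n, has_walk eV x y n & n <= h + 2.
Proof.
move=> [[vtx labK vtxK] labE]; have [n w nh] := stacked_walk (lab x) (lab y).
exists n => //; rewrite -(labK x) -(labK y).
by apply: has_walk_homo w => u v; rewrite -labE !vtxK.
Qed.

(** Above, a walk crosses the new edge once, with at most [h + 2] steps on each side. Below, a
    potential separates two vertices farthest from the ends of that edge. *)
Lemma join_edge_diameter (T1 T2 : finType) (e1 : rel T1) (e2 : rel T2)
    (lab1 : T1 -> 'I_(2 * L)) (lab2 : T2 -> 'I_(2 * L)) (a : T1) (b : T2) :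
  stacked_labelling e1 lab1 -> stacked_labelling e2 lab2 ->
  floor_vertex lab1 a -> floor_vertex lab2 b ->
  graph_diameter (join_edge e1 e2 a b) (L + 4).
Proof.
move=> st1 st2 fa fb; set e12 := join_edge e1 e2 a b.
have w1 x y : exists2 n, has_walk e12 (inl x) (inl y) n & n <= h + 2.
  have [n w nh] := labelled_walk x y st1.
  by exists n => //; apply: (@has_walk_homo _ _ e1 _ inl) w.
have w2 x y : exists2 n, has_walk e12 (inr x) (inr y) n & n <= h + 2.
  have [n w nh] := labelled_walk x y st2.
  by exists n => //; apply: (@has_walk_homo _ _ e2 _ inr) w.
have wab : has_walk e12 (inl a) (inr b) 1 by apply: has_walk1; rewrite /= !eqxx.
have wba : has_walk e12 (inr b) (inl a) 1 by apply: has_walk1; rewrite /= !eqxx.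
have bounded x y : exists2 n, graph_distance e12 x y n & n <= L + 4.
  suff [n w nL] : exists2 n, has_walk e12 x y n & n <= L + 4.
    by have [m dm mn] := has_walk_distance w; exists m => //; apply: leq_trans mn nL.
  case: x y => [x|x] [y|y].
  - by have [n w nh] := w1 x y; exists n; last lia.
  - have [m w mh] := w1 x a; have [n w' nh] := w2 b y.
    by exists (m + 1 + n); [apply: has_walk_trans (has_walk_trans w wab) w' | lia].
  - have [m w mh] := w2 x b; have [n w' nh] := w1 a y.
    by exists (m + 1 + n); [apply: has_walk_trans (has_walk_trans w wba) w' | lia].
  - by have [n w nh] := w2 x y; exists n; last lia.
split=> //.
have [[vtx1 lab1K vtx1K] lab1E] := st1; have [[vtx2 lab2K vtx2K] lab2E] := st2.
have [x dx] := floor_dist_max fa; have [y dy] := floor_dist_max fb.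
exists (inl (vtx1 x)), (inr (vtx2 y)).
have [n dn nL] := bounded (inl (vtx1 x)) (inr (vtx2 y)).
(* Signed distance to the joining edge, shifted to take values in [nat]. *)
pose pot (u : T1 + T2) : nat := match u with
  | inl u => h + 2 - floor_dist (lab1 a) (lab1 u)
  | inr u => h + 3 + floor_dist (lab2 b) (lab2 u) end.
have pot_lip u v : e12 u v -> pot v <= pot u + 1.
  case: u v => [u|u] [v|v] /=.
  - by rewrite -lab1E => /(floor_dist_adj fa)[]; lia.
  - by move=> /andP[/eqP-> /eqP->]; rewrite /floor_dist !eqxx; lia.
  - by move=> /andP[/eqP-> /eqP->]; rewrite /floor_dist !eqxx; lia.
  - by rewrite -lab2E => /(floor_dist_adj fb)[]; lia.
have := has_walk_lipschitz pot_lip dn.1.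
(* The potential runs from 0 to [2h + 5 = L + 4]. *)
rewrite /= vtx1K vtx2K dx dy => pot_n.
by have -> : L + 4 = n by [rewrite /L in nL *; lia]; exact: dn.
Qed.

End OddStacked.

End Graphs.

Theorem theorem40 (p : nat) (p_prime : prime p)
    (p_mod : (p = 71 %[mod 120] \/ p = 119 %[mod 120])%N)
    (P : prime_idealr (quad_int p)) (P_above_2 : 2%:R \in P)
    (L : nat) (ord_L : ideal_class_order [set` P] L)
    (T1 T2 : finType) (e1 : rel T1) (e2 : rel T2)
    (lab1 : T1 -> 'I_(2 * L)) (lab2 : T2 -> 'I_(2 * L))
    (stacked1 : stacked_labelling e1 lab1)
    (stacked2 : stacked_labelling e2 lab2)
    (a : T1) (b : T2)
    (floor_a : floor_vertex lab1 a) (floor_b : floor_vertex lab2 b) :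
  graph_diameter (join_edge e1 e2 a b) (L + 4)%N.
Proof.
(* Both 71 and 119 are 7 modulo 8, and either residue modulo 120 forces [p] to be at least 71. *)
have [p7 p8] : p = 7 %[mod 8] /\ (8 < p)%N.
  by have := prime_gt1 p_prime; case: p_mod => /=; lia.
have [L_odd L1] := prime_above_2_order p_prime p7 p8 P_above_2 ord_L.
have [h h_gt0 LE] : exists2 h, (0 < h)%N & L = h.*2.+1 by exists L./2; lia.
by subst L; apply: (join_edge_diameter h_gt0 stacked1 stacked2).
Qed.
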